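(* Let $G$ be a finite simple connected graph with $\chi(G) = \Delta(G)$, and suppose $G$ is not isomorphic to $\overline{C_7}$. Then $G$ contains either a complete graph $K_{\Delta(G)}$ as a subgraph or a high odd hole.
   Context: $\chi(G)$ denotes the chromatic number and $\Delta(G)$ the maximum degree of $G$. $\overline{C_7}$ is the complement of the cycle on seven vertices. An odd hole in $G$ is an induced (chordless) cycle of odd length at least five. A high odd hole is an odd hole in $G$ in which every vertex has degree at least $\Delta(G)-1$ in $G$. *)

(* Defs.v *)
From mathcomp Require Import all_boot.
Set Implicit Arguments.
Unset Strict Implicit.
Unset Printing Implicit Defensive.

Record sgraph := SGraph {
  svertex :> finType;
  sedge : rel svertex;
  sedge_sym : symmetric sedge;
  sedge_irrefl : irreflexive sedge }.

Arguments sedge {s} x y.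

Definition connected_graph (G : sgraph) : Prop :=
  forall x y : G, connect (@sedge G) x y.

Definition degree (G : sgraph) (x : G) : nat := #|[set y : G | sedge x y]|.

Definition max_degree (G : sgraph) : nat := \max_(x : G) degree x.

Definition proper_coloring (G : sgraph) (k : nat) (c : {ffun G -> 'I_k}) : bool :=
  [forall x : G, forall y : G, sedge x y ==> (c x != c y)].

Definition colorable (G : sgraph) (k : nat) : bool :=
  [exists c : {ffun G -> 'I_k}, proper_coloring c].

Lemma colorable_exists (G : sgraph) : exists k, colorable G k.
Proof.
exists #|G|; apply/existsP; exists [ffun x : G => enum_rank x].
apply/forallP => x; apply/forallP => y; apply/implyP => xy; rewrite !ffunE.
by apply: contraTneq xy => /enum_rank_inj ->; rewrite sedge_irrefl.
Qed.

Definition chromatic_number (G : sgraph) : nat := ex_minn (colorable_exists G).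

Definition isomorphic (G H : sgraph) : Prop :=
  exists2 f : G -> H, bijective f & {mono f : x y / sedge x y}.

Definition contains_subgraph (G H : sgraph) : Prop :=
  exists2 f : H -> G, injective f & {homo f : x y / sedge x y}.

Definition complete_rel (n : nat) : rel 'I_n := fun i j => i != j.

Lemma complete_sym (n : nat) : symmetric (@complete_rel n).
Proof. by move=> i j; rewrite /complete_rel eq_sym. Qed.

Lemma complete_irrefl (n : nat) : irreflexive (@complete_rel n).
Proof. by move=> i; rewrite /complete_rel eqxx. Qed.

Definition complete_graph (n : nat) : sgraph :=
  SGraph (@complete_sym n) (@complete_irrefl n).

(* [ordS] is the successor modulo n.  The guard [i != j] only matters for
   n = 1; this is the cycle C_n for n >= 3. *)
Definition cycle_rel (n : nat) : rel 'I_n :=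
  fun i j => (i != j) && ((ordS i == j) || (ordS j == i)).

Lemma cycle_sym (n : nat) : symmetric (@cycle_rel n).
Proof. by move=> i j; rewrite /cycle_rel eq_sym orbC. Qed.

Lemma cycle_irrefl (n : nat) : irreflexive (@cycle_rel n).
Proof. by move=> i; rewrite /cycle_rel eqxx. Qed.

Definition cycle_graph (n : nat) : sgraph :=
  SGraph (@cycle_sym n) (@cycle_irrefl n).

Definition compl_rel (G : sgraph) : rel G :=
  fun x y => (x != y) && ~~ sedge x y.

Lemma compl_sym (G : sgraph) : symmetric (@compl_rel G).
Proof. by move=> x y; rewrite /compl_rel eq_sym sedge_sym. Qed.

Lemma compl_irrefl (G : sgraph) : irreflexive (@compl_rel G).
Proof. by move=> x; rewrite /compl_rel eqxx. Qed.

Definition compl_graph (G : sgraph) : sgraph :=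
  SGraph (@compl_sym G) (@compl_irrefl G).

(* [{mono ...}] (edges preserved and reflected) makes the cycle induced. *)
Definition odd_hole (G : sgraph) (k : nat) (h : cycle_graph k -> G) : Prop :=
  [/\ odd k, 5 <= k, injective h & {mono h : i j / sedge i j}].

Definition has_high_odd_hole (G : sgraph) : Prop :=
  exists (k : nat) (h : cycle_graph k -> G),
    odd_hole h /\ forall i, (max_degree G).-1 <= degree (h i).

(* Main.v *)
Require Import Defs.
From mathcomp Require Import all_boot zify.
From Stdlib Require Import Classical.

(* Let n = Delta - 1, let U be a minimal set of vertices that is not
   n-colourable, and suppose that U contains no odd hole.  Fix v in U and an
   n-colouring of U - v.  If the colour of a neighbour x of v occurs only once
   around v, then for every other colour j a shortest Kempe chain from x to a
   neighbour y of v coloured j closes up through v to an odd cycle, so x is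
   adjacent to such a y.  If v has n neighbours in U, this gives K_Delta.
   Otherwise U is all of G, G is Delta-regular, and N(v) consists of two
   non-adjacent vertices a, b of the same colour and a clique in which each
   vertex sees a or b, where neither a nor b sees the whole clique.  In a regular
   graph the sets N(u) - N[v] and N(v) - N[u] have the same size for adjacent u
   and v; applied to v and the vertices of N(v), this leaves only the path on four
   vertices for N(v).  A connected graph in which every neighbourhood is such a
   path is the square of a cycle C_m with m >= 7: for m = 7 this is the complement
   of C_7, and for m >= 8 it contains an odd hole. *)

Set Implicit Arguments.
Unset Strict Implicit.
Unset Printing Implicit Defensive.

Lemma first_repetition (T : finType) (w : nat -> T) :
  exists m, {in gtn m &, injective w} /\ exists2 j, j < m & w j = w m.
Proof.
have repeats : exists m, ~~ uniq (mkseq w m.+1).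
  exists #|T|; apply/negP=> /card_uniqP; rewrite size_mkseq => wcard.
  by have := max_card [in mkseq w #|T|.+1]; rewrite wcard ltnn.
have [m wm mmin] := ex_minnP repeats; exists m.
have uniq_w : uniq (mkseq w m).
  by case: m mmin {wm} => // m mmin; apply: contraT => /mmin; rewrite ltnn.
split; first exact/mkseq_uniqP.
move: wm; rewrite mkseqS rcons_uniq uniq_w andbT negbK => /mapP[j].
by rewrite mem_iota => jm wmj; exists j.
Qed.

Lemma onto_leq_inj (T : finType) (A : {set T}) n (f : T -> nat) :
  (forall i, i < n -> exists2 x, x \in A & f x = i) -> #|A| <= n ->
  {in A &, injective f}.
Proof.
move=> fonto An; apply/dinjectiveP.
apply: (@leq_size_uniq _ (iota 0 n)); first exact: iota_uniq.
  by move=> i; rewrite mem_iota => /fonto[x xA <-]; rewrite map_f ?mem_enum.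
by rewrite size_map size_iota -cardE.
Qed.

Lemma onto_card_geq (T : finType) (A : {set T}) n (f : T -> nat) :
  (forall i, i < n -> exists2 x, x \in A & f x = i) -> n <= #|A|.
Proof.
move=> fonto; have sub : {subset iota 0 n <= map f (enum A)}.
  by move=> i; rewrite mem_iota => /fonto[x xA <-]; rewrite map_f ?mem_enum.
by have := uniq_leq_size (iota_uniq 0 n) sub; rewrite size_iota size_map -cardE.
Qed.

Lemma onto_card_succ (T : finType) (A : {set T}) n (f : T -> nat) :
  {in A, forall x, f x < n} ->
  (forall i, i < n -> exists2 x, x \in A & f x = i) -> #|A| = n.+1 ->
  exists a b, [/\ a \in A, b \in A, a != b, f a = f b & {in A :\ b &, injective f}].
Proof.
move=> fn fonto cardA.
have sub : {subset map f (enum A) <= iota 0 n}.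
  by move=> i /mapP[x]; rewrite mem_enum mem_iota => /fn fx ->.
have /dinjectivePn[b bA [a /andP[/= ab aA] fab]] : ~~ dinjectiveb f A.
  apply/negP=> finj; have := uniq_leq_size finj sub.
  by rewrite size_iota size_map -cardE cardA ltnn.
exists a, b; split=> //; apply: (@onto_leq_inj _ _ n).
  move=> i /fonto[x xA fx]; have [xb|xb] := eqVneq x b.
    by exists a; [rewrite in_setD1 ab | rewrite -fab -xb].
  by exists x; rewrite ?in_setD1 ?xb.
by have := cardsD1 b A; rewrite bA cardA; lia.
Qed.

Section SimpleGraphs.
Variable G : sgraph.
Implicit Types (x y v a b : G) (U K : {set G}).

Lemma sedge_neq x y : sedge x y -> x != y.
Proof. by apply: contraTneq => ->; rewrite sedge_irrefl. Qed.

Lemma leq_max_degree v : degree v <= max_degree G.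
Proof. exact: leq_bigmax. Qed.

Lemma connected_closed (A : {pred G}) x y : connected_graph G ->
  {in A, forall u w, sedge u w -> w \in A} -> x \in A -> y \in A.
Proof.
move=> Gconn Acl xA.
have Aclosed : closed (@sedge G) A.
  apply: intro_closed; first exact/sym_connect_sym/sedge_sym.
  by move=> u w uw uA; apply: Acl uw.
by rewrite -(closed_connect Aclosed (Gconn x y)).
Qed.

Definition nbhd U v : {set G} := [set y in U | sedge v y].

Lemma nbhdT v : nbhd [set: G] v = [set y | sedge v y].
Proof. by apply/setP=> y; rewrite !inE. Qed.

Lemma card_nbhd_degree U v : #|nbhd U v| <= degree v.
Proof. by apply/subset_leq_card/subsetP=> y; rewrite !inE => /andP[]. Qed.

Lemma nbhd_subD1 U v : nbhd U v \subset U :\ v.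
Proof.
by apply/subsetP=> y; rewrite !inE => /andP[-> /sedge_neq]; rewrite eq_sym andbT.
Qed.

Lemma mem_nbhd_max_degree U v w : #|nbhd U v| = max_degree G -> sedge v w -> w \in U.
Proof.
move=> cardN vw; have sub : nbhd U v \subset [set y | sedge v y].
  by apply/subsetP=> y; rewrite !inE => /andP[].
have : nbhd U v == [set y | sedge v y] by rewrite eqEcard sub cardN leq_max_degree.
by move/eqP/setP/(_ w); rewrite !inE vw => /andP[].
Qed.

Definition clique K : Prop := {in K &, forall x y, x != y -> sedge x y}.

Definition has_clique (m : nat) : Prop := exists2 K, clique K & #|K| = m.

Lemma clique_setU1 K v :
  {in K, forall x, sedge v x} -> clique K -> clique (v |: K).
Proof.
move=> vK cK x y /setU1P[->|xK] /setU1P[->|yK]; rewrite ?eqxx // => xy.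
- exact: vK.
- by rewrite sedge_sym vK.
- exact: cK.
Qed.

Lemma clique_nbhd_has_clique U K v :
  clique K -> K \subset nbhd U v -> has_clique #|K|.+1.
Proof.
move=> cK /subsetP KN; exists (v |: K).
  by apply: clique_setU1 => // x /KN; rewrite inE => /andP[].
suff vK : v \notin K by rewrite cardsU1 vK.
by apply/negP=> /KN; rewrite inE sedge_irrefl andbF.
Qed.

Lemma nbhd_minus_clique_leaf U v a b : ~ has_clique #|nbhd U v| ->
  a \in nbhd U v -> b \in nbhd U v -> a != b -> clique (nbhd U v :\: [set a; b]) ->
  exists2 x, x \in nbhd U v :\: [set a; b] & ~~ sedge x a.
Proof.
move=> noclique aN bN ab; set Q := _ :\: _ => Qclique.
apply/exists_inP; rewrite -negb_forall_in; apply/negP=> /forall_inP Qa.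
have abN : [set a; b] \subset nbhd U v by rewrite subUset !sub1set aN.
have cardaQ : (#|a |: Q|).+1 = #|nbhd U v|.
  have := subset_leq_card abN.
  by rewrite [#|a |: Q|]cardsU1 /Q in_setD set21 cardsDS // cards2 ab; lia.
apply: noclique; rewrite -cardaQ; apply: (@clique_nbhd_has_clique U _ v).
  by apply: clique_setU1 => // x /Qa; rewrite sedge_sym.
by rewrite subUset sub1set aN subsetDl.
Qed.

Lemma has_clique_subgraph m :
  has_clique m -> contains_subgraph G (complete_graph m).
Proof.
case=> K Kcl <-; exists (fun i : 'I_#|K| => enum_val i); first exact: enum_val_inj.
move=> i j ij; apply: Kcl; rewrite ?enum_valP //.
by apply: contra ij => /eqP/enum_val_inj->.
Qed.

Lemma sedge_mono_ltn k (e : rel 'I_k) (h : 'I_k -> G) :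
  symmetric e -> irreflexive e ->
  (forall i j : 'I_k, i < j -> sedge (h i) (h j) = e i j) ->
  {mono h : i j / e i j >-> sedge i j}.
Proof.
move=> e_sym e_irr hlt i j; have [ij|ji|/val_inj->] := ltngtP i j.
- exact: hlt.
- by rewrite sedge_sym hlt // e_sym.
- by rewrite sedge_irrefl e_irr.
Qed.

End SimpleGraphs.

Lemma embedding_isomorphic (G H : sgraph) (h : H -> G) (x0 : H) :
  connected_graph G -> injective h -> {mono h : x y / sedge x y} ->
  (forall x y, sedge (h x) y -> y \in codom h) -> isomorphic G H.
Proof.
move=> Gconn hinj hmono hcl.
have full y : y \in codom h.
  apply: (@connected_closed _ (mem (codom h)) (h x0)) => //; last exact: codom_f.
  by move=> _ /codomP[x ->]; apply: hcl.
have [|g hK gK] := inj_card_bij hinj.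
  by rewrite -(card_codom hinj); apply/subset_leq_card/subsetP.
exists g; first by exists h.
by move=> y z; rewrite -hmono !gK.
Qed.

Section Holes.
Variable G : sgraph.
Implicit Types (x y z v s t : G) (p q : seq G) (S U : {set G}).

Definition hole_in U : Prop :=
  exists (k : nat) (h : cycle_graph k -> G), odd_hole h /\ forall i, h i \in U.

Lemma cycle_relE k (i j : 'I_k) : i < j ->
  cycle_rel i j = (j == i.+1 :> nat) || ((i == 0 :> nat) && (j.+1 == k)).
Proof.
move=> ij; have jk := ltn_ord j.
rewrite /cycle_rel -!val_eqE /= neq_ltn ij /= modn_small; last by lia.
rewrite eq_sym; congr (_ || _).
have [e|ne] := eqVneq j.+1 k; first by rewrite andbT e modnn eq_sym.
by rewrite andbF modn_small; lia.
Qed.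

Lemma hole_in_seq U (c : nat -> G) k : odd k -> 4 < k ->
  (forall i, i < k -> c i \in U) -> {in gtn k &, injective c} ->
  (forall i j, i < j < k ->
     sedge (c i) (c j) = (j == i.+1) || ((i == 0) && (j.+1 == k))) ->
  hole_in U.
Proof.
move=> kodd k5 cU cinj cadj; exists k, (fun i : 'I_k => c i); split; last first.
  by move=> i; apply: cU.
split=> //; first by move=> i j /cinj eij; apply/val_inj/eij; rewrite !inE.
apply: (sedge_mono_ltn (@cycle_sym k) (@cycle_irrefl k)) => i j ij.
by rewrite cycle_relE // cadj // ij ltn_ord.
Qed.

Definition induced_rel S : rel G :=
  [rel x y | [&& x \in S, y \in S & sedge x y]].

Lemma connect_inducedS S S' x y :
  S \subset S' -> connect (induced_rel S) x y -> connect (induced_rel S') x y.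
Proof.
move=> /subsetP SS'; apply: connect_sub => u w /and3P[uS wS uw].
by apply/connect1/and3P; split; rewrite ?SS'.
Qed.

Definition component S x : {set G} := [set y in S | connect (induced_rel S) x y].

Lemma component_closed S x :
  {in component S x & S, forall y z, sedge y z -> z \in component S x}.
Proof.
move=> y z; rewrite !inE => /andP[yS xy] zS yz; rewrite zS.
by apply: connect_trans xy (connect1 _); apply/and3P.
Qed.

Definition touches x : pred G := [pred z | (z == x) || sedge x z].

Fixpoint chordless x p : bool :=
  if p is y :: p' then [&& sedge x y, ~~ has (touches x) p' & chordless y p']
  else true.

Lemma chordless_extend x y q :
  chordless y q -> has (touches x) (y :: q) ->
  exists q', [/\ chordless x q', last x q' = last y q & {subset q' <= y :: q}].
Proof.
elim: q y => [|z q IH] y cyq xyq.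
  move: xyq; rewrite /= orbF => /orP[/eqP<-|xy]; first by exists [::].
  by exists [:: y]; split=> //=; rewrite xy.
have [xzq|xzq] := boolP (has (touches x) (z :: q)).
  have /and3P[_ _ czq] := cyq; have [q' [cq' lq' sq']] := IH z czq xzq.
  by exists q'; split=> // w /sq' wq; rewrite inE wq orbT.
move: xyq; rewrite -cat1s has_cat has_seq1 (negbTE xzq) orbF => /orP[/eqP yx|xy].
  by exists (z :: q); split=> [||w wq]; rewrite -?yx // inE wq orbT.
by exists (y :: z :: q); split=> //; apply/and3P.
Qed.

Lemma connect_chordless S s t :
  connect (induced_rel S) s t -> s \in S ->
  exists q, [/\ chordless s q, last s q = t & {subset s :: q <= S}].
Proof.
case/connectP=> p; elim: p s => [|y p IH] s.
  by move=> _ -> sS; exists [::]; split=> // z; rewrite inE => /eqP->.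
case/andP=> /and3P[_ yS sy] py tE sS.
have [q [cq lq sq]] := IH y py tE yS.
have [|q' [cq' lq' sq']] := @chordless_extend s y q cq.
  by rewrite /= /touches /= sy orbT.
exists q'; split=> //; first by rewrite lq'.
by move=> z; rewrite inE => /orP[/eqP->//|/sq'/sq].
Qed.

Lemma chordless_uniq x p : chordless x p -> uniq (x :: p).
Proof.
elim: p x => [//|y p IH] x /and3P[xy xp cp].
rewrite cons_uniq IH // andbT inE negb_or sedge_neq //=.
by apply: contra xp => xp; apply/hasP; exists x; rewrite //= /touches /= eqxx.
Qed.

Lemma chordless_nth x0 x p i j : chordless x p -> i < j <= size p ->
  sedge (nth x0 (x :: p) i) (nth x0 (x :: p) j) = (j == i.+1).
Proof.
elim: p x i j => [|y p IH] x i j; first by rewrite /=; lia.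
case/and3P=> xy xp cp; case: j => [|j]; first by lia.
case: i => [|i]; last by rewrite eqSS ltnS; apply: IH.
case: j => [|j] ij; first by rewrite /= xy.
apply: contraNF xp => xj; apply/hasP; exists (nth x0 p j); first exact: mem_nth.
by apply/orP; right.
Qed.

Lemma chordless_parity (g : G -> bool) S x p :
  {in S &, forall x y, sedge x y -> g x != g y} ->
  {subset x :: p <= S} -> chordless x p -> g (last x p) = g x (+) odd (size p).
Proof.
move=> gS; elim: p x => [|y p IH] x sS /=; first by rewrite addbF.
case/and3P=> xy _ cp; rewrite IH //; last by move=> z zp; rewrite sS // inE zp orbT.
have : g x != g y by apply: gS => //; apply: sS; rewrite !inE eqxx ?orbT.
by case: (g x) (g y) (odd _) => [] [] [].
Qed.

Lemma chordless_apex_hole U v s q :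
  v \in U -> {subset s :: q <= U} -> v \notin s :: q -> chordless s q ->
  {in s :: q, forall y, sedge v y = (y == s) || (y == last s q)} ->
  odd (size q) -> 2 < size q -> hole_in U.
Proof.
move=> vU sU vq cq vE oq szq; pose c := v :: s :: q.
have uniq_c : uniq c by rewrite cons_uniq vq chordless_uniq.
apply: (@hole_in_seq U (nth v c) (size c)); rewrite /= ?negbK //.
- move=> i ic; have : nth v c i \in c by rewrite mem_nth.
  by rewrite inE => /orP[/eqP->|/sU].
- by move=> i j ic jc /eqP; rewrite nth_uniq // => /eqP.
- move=> [|i] [|j] // /andP[ij jc]; last first.
    by rewrite [nth v c i.+1]/= [nth v c j.+1]/= chordless_nth ?orbF //=; lia.
  rewrite [nth v c 0]/= [nth v c j.+1]/= vE ?mem_nth //.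
  rewrite -[s in _ == s]/(nth v (s :: q) 0) (last_nth v).
  by rewrite !nth_uniq ?chordless_uniq.
Qed.

(* Between vertices of opposite sides, a shortest path in the bipartite graph
   G[S] closes up through v to an odd cycle, which is chordless. *)
Lemma bipartite_link_adj U S v s t (g : G -> bool) :
  ~ hole_in U -> v \in U -> S \subset U -> v \notin S ->
  {in S &, forall x y, sedge x y -> g x != g y} ->
  {in S, forall y, sedge v y = (y == s) || (y == t)} ->
  s \in S -> connect (induced_rel S) s t -> g s != g t -> sedge s t.
Proof.
move=> nohole vU SU vS gS vE sS st gst.
have [q [cq lq sq]] := connect_chordless st sS.
have oq : odd (size q).
  by move: gst; rewrite -lq (chordless_parity gS sq cq); case: (g s) (odd _) => [] [].
have [szq|szq] := leqP (size q) 2.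
  case: q oq szq lq cq {sq} => [|y [|z [|]]] //= _ _ <-.
  by case/andP.
case: nohole; apply: (chordless_apex_hole vU _ _ cq _ oq szq).
- by move=> z /sq; apply/subsetP.
- by apply: contra vS => /sq.
- by move=> y /sq yS; rewrite lq vE.
Qed.

End Holes.

Section Kempe.
Variable G : sgraph.
Implicit Types (x y z v a b : G) (U W S D : {set G}) (f : G -> nat).

Definition proper_on n U f : Prop :=
  {in U, forall x, f x < n} /\ {in U &, forall x y, sedge x y -> f x != f y}.

Definition colorable_on n U : Prop := exists f, proper_on n U f.

Lemma colorable_onT n : colorable_on n [set: G] -> colorable G n.
Proof.
case=> f [fn fp]; apply/existsP; exists [ffun x => Ordinal (fn x (in_setT x))].
apply/forallP=> x; apply/forallP=> y; apply/implyP=> xy.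
by rewrite !ffunE -val_eqE /= fp.
Qed.

Lemma chromatic_number_leq n : colorable_on n [set: G] -> chromatic_number G <= n.
Proof.
move=> /colorable_onT coln; rewrite /chromatic_number.
by case: ex_minnP => m _; apply.
Qed.

Definition bichromatic W f (i j : nat) : {set G} :=
  [set y in W | (f y == i) || (f y == j)].

Lemma bichromatic_bipartite n W f i j : proper_on n W f ->
  {in bichromatic W f i j &, forall x y, sedge x y -> (f x == i) != (f y == i)}.
Proof.
move=> [_ fp] x y; rewrite !inE => /andP[xW xc] /andP[yW yc] xy.
have := fp _ _ xW yW xy.
case: (eqVneq (f x) i) xc => [->|_] /= xc; case: (eqVneq (f y) i) yc => [->|_] //= yc.
by rewrite (eqP xc) (eqP yc) eqxx.
Qed.

Definition kempe_swap f (i j : nat) D y : nat :=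
  if y \in D then if f y == i then j else i else f y.

Lemma kempe_swap_proper n W D f i j :
  proper_on n W f -> i < n -> j < n -> D \subset bichromatic W f i j ->
  {in D & bichromatic W f i j, forall y z, sedge y z -> z \in D} ->
  proper_on n W (kempe_swap f i j D).
Proof.
move=> [fn fp] ilt jlt /subsetP DB Dcl; split.
  by move=> x xW; rewrite /kempe_swap; do 2?case: ifP => // _; apply: fn.
have leaving x y : x \in W -> y \in W -> x \in D -> y \notin D -> sedge x y ->
    kempe_swap f i j D x != kempe_swap f i j D y.
  move=> xW yW xD yD xy; rewrite /kempe_swap xD (negbTE yD).
  have : y \notin bichromatic W f i j by apply: contra yD => yB; apply: Dcl xy.
  rewrite inE yW /= negb_or => /andP[yi yj].
  by case: ifP => _; rewrite eq_sym.
move=> x y xW yW xy; case xD: (x \in D); case yD: (y \in D).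
- rewrite /kempe_swap xD yD; have := fp _ _ xW yW xy.
  have := DB _ xD; have := DB _ yD; rewrite !inE xW yW !andTb.
  have [->|ji] := eqVneq j i; first by case/orP=> /eqP-> /orP[]/eqP->; rewrite eqxx.
  by case/orP=> /eqP-> /orP[]/eqP->; rewrite !eqxx // ?(negbTE ji) // eq_sym.
- by apply: leaving => //; rewrite yD.
- by rewrite eq_sym; apply: leaving; rewrite ?xD // sedge_sym.
- by rewrite /kempe_swap xD yD; apply: fp.
Qed.

Definition singly_colored U f v x : Prop :=
  x \in nbhd U v /\ {in nbhd U v, forall y, f y = f x -> y = x}.

(* The complement of G[N] is a double star with centres a, b, both having a
   leaf, together with isolated vertices. *)
Record double_star (N : {set G}) a b : Prop := DoubleStar {
  ds_center_l : a \in N;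
  ds_center_r : b \in N;
  ds_neq : a != b;
  ds_nadj : ~~ sedge a b;
  ds_clique : clique (N :\: [set a; b]);
  ds_dom : {in N :\: [set a; b], forall x, sedge x a || sedge x b};
  ds_leaf_l : exists2 x, x \in N :\: [set a; b] & ~~ sedge x a;
  ds_leaf_r : exists2 x, x \in N :\: [set a; b] & ~~ sedge x b }.

Lemma double_star_sym (N : {set G}) a b : double_star N a b -> double_star N b a.
Proof.
case=> aN bN ab nab cl dom la lb.
split; rewrite 1?[[set b; a]]setUC // 1?eq_sym 1?sedge_sym //.
by move=> x /dom; rewrite orbC.
Qed.

Section AlmostColorable.
Variables (n : nat) (U : {set G}) (v : G).
Hypothesis uncolorable : ~ colorable_on n U.
Hypothesis vU : v \in U.

Lemma nbhd_meets_color f : proper_on n (U :\ v) f ->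
  forall i, i < n -> exists2 x, x \in nbhd U v & f x = i.
Proof.
move=> [fn fp] i ilt; have [/existsP[x /andP[xN /eqP fx]]|/existsPn none] :=
  boolP [exists x, (x \in nbhd U v) && (f x == i)]; first by exists x.
case: uncolorable; exists (fun y => if y == v then i else f y); split.
  by move=> x xU; case: eqVneq => // xv; apply: fn; rewrite !inE xv.
move=> x y xU yU xy; case: (eqVneq x v) => [xv|xv]; case: (eqVneq y v) => [yv|yv].
- by move: xy; rewrite xv yv sedge_irrefl.
- by have := none y; rewrite inE yU -xv xy eq_sym.
- by have := none x; rewrite inE xU -yv sedge_sym xy.
- by apply: fp => //; rewrite !inE ?xv ?yv.
Qed.

Variable f : G -> nat.
Hypothesis fP : proper_on n (U :\ v) f.

Lemma nbhd_color_ltn : {in nbhd U v, forall x, f x < n}.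
Proof. by move=> x /(subsetP (nbhd_subD1 U v)); apply: fP.1. Qed.

(* Otherwise swapping the colours f x and j on D would leave the colour of x
   unused around v. *)
Lemma kempe_closed_meets x j D : j < n -> singly_colored U f v x -> x \in D ->
  D \subset bichromatic (U :\ v) f (f x) j ->
  {in D & bichromatic (U :\ v) f (f x) j, forall y z, sedge y z -> z \in D} ->
  exists y, [/\ y \in nbhd U v, y \in D & f y = j].
Proof.
move=> jn [xN xu] xD DB Dcl.
have gP := kempe_swap_proper fP (nbhd_color_ltn xN) jn DB Dcl.
have [y yN] := nbhd_meets_color gP (nbhd_color_ltn xN).
rewrite /kempe_swap; case: ifP => [yD|yD /(xu _ yN) yx]; last by rewrite yx xD in yD.
have := subsetP DB _ yD; rewrite inE => /andP[_].
have [fyx _ jfx|_ /= /eqP fy _] := eqVneq (f y) (f x); last by exists y.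
by exists y; split=> //; rewrite fyx jfx.
Qed.

Hypothesis nohole : ~ hole_in U.

Lemma kempe_chain_adj S x z :
  x \in nbhd U v -> z \in nbhd U v -> f z != f x ->
  S \subset bichromatic (U :\ v) f (f x) (f z) ->
  {in S, forall y, sedge v y -> y = x \/ y = z} ->
  x \in S -> connect (induced_rel S) x z -> sedge x z.
Proof.
move=> xN zN fzx SB Sv xS xz.
have SU : S \subset U :\ v.
  by apply: subset_trans SB _; apply/subsetP=> y; rewrite inE => /andP[].
apply: (@bipartite_link_adj G U S v x z (fun y => f y == f x)) => //.
- exact: subset_trans SU (subsetDl _ _).
- by apply: contraTN isT => /(subsetP SU); rewrite !inE eqxx.
- move=> y y' /(subsetP SB) yB /(subsetP SB) y'B.
  exact: bichromatic_bipartite fP _ _ yB y'B.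
- move=> y yS; apply/idP/orP=> [/(Sv y yS)[]->|[]/eqP->]; rewrite ?eqxx; auto.
    by move: xN; rewrite inE => /andP[].
  by move: zN; rewrite inE => /andP[].
- by rewrite eqxx (negbTE fzx).
Qed.

(* The (f x, j)-component D of x that avoids the neighbours of v coloured j is
   not closed, so some such neighbour z is adjacent to D, and v sees only x and
   z in D + z. *)
Lemma singly_colored_adj_color x j : singly_colored U f v x -> j < n -> j != f x ->
  exists y, [/\ y \in nbhd U v, f y = j & sedge x y].
Proof.
move=> xs jn jx; have [xN xu] := xs.
have [/existsP[y /and3P[yN /eqP fy xy]]|/existsPn noadj] :=
  boolP [exists y, [&& y \in nbhd U v, f y == j & sedge x y]]; first by exists y.
pose S := bichromatic (U :\ v) f (f x) j.
pose Y := [set y in nbhd U v | f y == j].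
have xSY : x \in S :\: Y.
  rewrite !inE eqxx (eq_sym (f x)) (negbTE jx) -in_setD1.
  by rewrite (subsetP (nbhd_subD1 U v)) ?andbF.
pose D := component (S :\: Y) x.
have DSY : D \subset S :\: Y by apply/subsetP=> y; rewrite inE => /andP[].
have no_exit z y : z \in S -> z \in Y -> y \in D -> ~~ sedge y z.
  move=> zS; rewrite inE => /andP[zN fz] yD; apply/negP=> yz.
  have := noadj z; rewrite zN fz /= => /negP; apply.
  apply: (@kempe_chain_adj (z |: (S :\: Y))) => //; rewrite ?(eqP fz) //.
  - by rewrite subUset sub1set zS subsetDl.
  - move=> w /setU1P[->|]; first by right.
    rewrite !inE => /and3P[wj /andP[_ wU] fw] vw; rewrite wU vw /= in wj.
    rewrite (negbTE wj) orbF in fw.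
    by left; apply: xu (eqP fw); rewrite inE wU.
  - by rewrite setU1r.
  - apply: (@connect_trans _ _ y).
      by move: yD; rewrite inE => /andP[_]; apply/connect_inducedS/subsetUr.
    apply/connect1/and3P; split=> //; last exact: setU11.
    by rewrite setU1r // (subsetP DSY).
have [] := @kempe_closed_meets x j D jn xs.
- by rewrite inE xSY connect0.
- exact: subset_trans DSY (subsetDl _ _).
- move=> y z yD zS yz; apply: (component_closed yD _ yz); rewrite in_setD zS andbT.
  by apply: contraL yz => zY; apply: no_exit.
- move=> y [yN /(subsetP DSY)]; rewrite inE => /andP[+ _] fy.
  by rewrite inE yN fy eqxx.
Qed.

Lemma singly_colored_clique (K : {set G}) :
  (forall x, x \in K -> singly_colored U f v x) -> clique K.
Proof.
move=> Ks x y /Ks xs /Ks [yN yu] xy.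
have fyx : f y != f x.
  by apply: contra xy => /eqP/(xs.2 _ yN)->.
by have [w [wN /(yu _ wN)-> ]] := singly_colored_adj_color xs (nbhd_color_ltn yN) fyx.
Qed.

Lemma tight_nbhd_has_clique : #|nbhd U v| = n -> has_clique G n.+1.
Proof.
move=> cardN; rewrite -cardN; apply: (@clique_nbhd_has_clique _ U _ v) => //.
apply: singly_colored_clique => x xN; split=> // y yN.
have finj : {in nbhd U v &, injective f}.
  by apply: onto_leq_inj (nbhd_meets_color fP) _; rewrite cardN.
exact: finj.
Qed.

Lemma nbhd_double_star : #|nbhd U v| = n.+1 -> ~ has_clique G n.+1 ->
  exists a b, double_star (nbhd U v) a b.
Proof.
move=> cardN; rewrite -cardN => noclique.
have [a [b [aN bN ab fab finj]]] :=
  onto_card_succ nbhd_color_ltn (nbhd_meets_color fP) cardN.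
pose Q := nbhd U v :\: [set a; b].
have QE x : (x \in Q) = [&& x \in nbhd U v, x != a & x != b].
  by rewrite in_setD in_set2 negb_or andbC.
have fa y : y \in nbhd U v -> f y = f a -> (y == a) || (y == b).
  move=> yN fy; have [//|yb] := eqVneq y b; first by rewrite orbT.
  by rewrite orbF; apply/eqP/finj; rewrite // in_setD1 ?ab ?yb.
have Qs x : x \in Q -> singly_colored U f v x.
  rewrite QE => /and3P[xN xa xb]; split=> // y yN fyx.
  have [yb|yb] := eqVneq y b; last by apply: finj; rewrite // in_setD1 ?xb ?yb.
  by have := fa x xN; rewrite -fyx yb fab (negbTE xa) (negbTE xb) => /(_ erefl).
have Qclique : clique Q by apply: singly_colored_clique.
exists a, b; split=> //.
- have [aU bU] := (subsetP (nbhd_subD1 U v) a aN, subsetP (nbhd_subD1 U v) b bN).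
  by apply/negP=> /(fP.2 a b aU bU); rewrite fab eqxx.
- move=> x xQ; have [xN xu] := Qs x xQ; move: (xQ); rewrite QE => /and3P[_ xa xb].
  have fax : f a != f x by apply: contra xa => /eqP/(xu _ aN)->.
  have [y [yN fya xy]] := singly_colored_adj_color (Qs x xQ) (nbhd_color_ltn aN) fax.
  by case/orP: (fa y yN fya) => /eqP<-; rewrite xy ?orbT.
- exact: nbhd_minus_clique_leaf.
- by rewrite /Q setUC in Qclique *; apply: nbhd_minus_clique_leaf; rewrite // eq_sym.
Qed.

End AlmostColorable.

Definition critical n U : Prop :=
  ~ colorable_on n U /\ {in U, forall v, colorable_on n (U :\ v)}.

Lemma critical_exists n U : ~ colorable_on n U -> exists W, critical n W.
Proof.
have [k] := ubnP #|U|; elim: k U => // k IH U /ltnSE-leUk uncol.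
have [[v vU uncolDv]|min] := classic (exists2 v, v \in U & ~ colorable_on n (U :\ v)).
  by apply: (IH (U :\ v)) => //; have := cardsD1 v U; rewrite vU; lia.
by exists U; split=> // v vU; apply: NNPP => uncolDv; apply: min; exists v.
Qed.

Lemma critical_nonempty n U : critical n U -> exists v, v \in U.
Proof.
move=> [uncol _]; apply/set0Pn/eqP=> U0; case: uncol; exists (fun=> 0).
by split=> x; rewrite U0 inE.
Qed.

Lemma critical_card_nbhd n U v : critical n U -> v \in U -> n <= #|nbhd U v|.
Proof.
move=> [uncol col] vU; have [f fP] := col v vU.
exact: (onto_card_geq (nbhd_meets_color uncol fP)).
Qed.

Lemma critical_regular_double_stars n U :
  connected_graph G -> max_degree G = n.+1 -> critical n U ->
  ~ hole_in U -> ~ has_clique G n.+1 ->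
  forall u, degree u = n.+1 /\ exists a b, double_star [set y | sedge u y] a b.
Proof.
move=> Gconn Delta Ucrit nohole noclique; have [uncol col] := Ucrit.
have cardN v : v \in U -> #|nbhd U v| = n.+1.
  move=> vU; have [f fP] := col v vU.
  have := critical_card_nbhd Ucrit vU.
  have := leq_trans (card_nbhd_degree U v) (leq_max_degree v); rewrite Delta.
  have [/(tight_nbhd_has_clique uncol vU fP nohole)//|] := eqVneq #|nbhd U v| n.
  by lia.
have [v vU] := critical_nonempty Ucrit.
have UT : U = [set: G].
  apply/setP=> y; rewrite [RHS]inE; apply: connected_closed Gconn _ vU => w w' wU.
  by apply: mem_nbhd_max_degree; rewrite Delta cardN.
move=> u; have uU : u \in U by rewrite UT inE.
have [f fP] := col u uU; have cardNu := cardN u uU.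
have := nbhd_double_star uncol uU fP nohole cardNu noclique.
by rewrite -cardNu UT nbhdT.
Qed.

End Kempe.

Section LocallyP4.
Variable G : sgraph.
Implicit Types (u v w x y z a b c q : G).
Local Notation N v := [set y | sedge v y].

Definition private_nbhd u v : {set G} :=
  [set w | [&& sedge u w, w != v & ~~ sedge v w]].

Lemma card_private_nbhdC u v : sedge u v -> degree u = degree v ->
  #|private_nbhd u v| = #|private_nbhd v u|.
Proof.
have split_degree s t : sedge s t ->
    degree s = #|N s :&: N t| + #|private_nbhd s t|.+1.
  move=> st; rewrite /degree -(cardsID (N t)).
  rewrite (_ : N s :\: N t = t |: private_nbhd s t).
    by rewrite cardsU1 !inE eqxx andbF.
  apply/setP=> w; rewrite !inE; case: eqVneq => [->|_]; last by rewrite andbC.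
  by rewrite st sedge_irrefl.
move=> uv; have vu : sedge v u by rewrite sedge_sym.
by rewrite (split_degree u v uv) (split_degree v u vu) setIC => /addnI[].
Qed.

Record path_nbhd v p0 p1 p2 p3 : Prop := PathNbhd {
  pn_mem : forall y, sedge v y = (y \in [:: p0; p1; p2; p3]);
  pn_adj : [/\ sedge p0 p1, sedge p1 p2 & sedge p2 p3];
  pn_nadj : [/\ ~~ sedge p0 p2, ~~ sedge p0 p3 & ~~ sedge p1 p3] }.

Definition locally_P4 : Prop := forall v, exists p0 p1 p2 p3, path_nbhd v p0 p1 p2 p3.

Section RegularDoubleStars.
Hypothesis regular : forall u v, degree u = degree v.
Hypothesis star : forall u, exists a b, double_star (N u) a b.

Lemma center_private v a b : double_star (N v) a b -> b \in private_nbhd v a.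
Proof.
move=> ds; have := ds_center_r ds; rewrite !inE => ->.
by rewrite eq_sym (ds_neq ds) (ds_nadj ds).
Qed.

Lemma leaf_private v a b x : x \in N v :\: [set a; b] -> ~~ sedge x a ->
  x \in private_nbhd v a /\ x != b.
Proof. by rewrite !inE (sedge_sym a) negb_or => /andP[/andP[-> ->] ->] ->. Qed.

Lemma card_private_center_gt1 v a b : double_star (N v) a b -> 1 < #|private_nbhd v a|.
Proof.
move=> ds; have [x xQ xa] := ds_leaf_l ds; have [xP xb] := leaf_private xQ xa.
by apply/card_gt1P; exists x, b; split=> //; apply: center_private.
Qed.

Lemma private_nbhd_subset_centers v a b c :
  double_star (N v) a b -> c \in N v :\: [set a; b] ->
  private_nbhd v c \subset [set a; b].
Proof.
move=> ds cQ; apply/subsetP=> w; rewrite inE => /and3P[vw wc]; apply: contraNT => wab.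
by apply: (ds_clique ds) => //; rewrite 1?eq_sym // inE wab inE.
Qed.

Lemma double_star_at_center v a b :
  double_star (N v) a b -> exists q, double_star (N a) v q.
Proof.
move=> ds; have va : sedge v a by have := ds_center_l ds; rewrite inE.
have := card_private_center_gt1 ds; rewrite (card_private_nbhdC va (regular v a)).
case/card_gt1P=> w [w' []]; rewrite !inE => /and3P[aw wv vw] /and3P[aw' w'v vw'] ww'.
have [p [q pq]] := star a.
have [/set2P[vp|vp]|vpq] := boolP (v \in [set p; q]).
- by exists q; rewrite vp.
- by exists p; rewrite vp; apply: double_star_sym.
have vQ : v \in N a :\: [set p; q] by rewrite inE vpq inE sedge_sym.
have center t : sedge a t -> t != v -> ~~ sedge v t -> t \in [set p; q].
  move=> adj_at tv vt; apply: (subsetP (private_nbhd_subset_centers pq vQ)).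
  by rewrite inE adj_at tv vt.
have := ds_dom pq vQ; move: ww' (vw) (vw').
by case/set2P: (center w aw wv vw) => ->; case/set2P: (center w' aw' w'v vw') => ->;
  rewrite ?eqxx // => _ /negbTE-> /negbTE->.
Qed.

(* Every private neighbour of a other than the second centre q of N(a) is
   adjacent to c, since c belongs to the clique of N(a). *)
Lemma card_private_center v a b c :
  double_star (N v) a b -> c \in N v :\: [set a; b] -> sedge c a ->
  #|private_nbhd v a| <= (#|private_nbhd v c|).+1.
Proof.
move=> ds cQ ca; have [q dsa] := double_star_at_center ds.
have va : sedge v a by have := ds_center_l ds; rewrite inE.
have vc : sedge v c by move: cQ; rewrite !inE => /andP[].
rewrite (card_private_nbhdC va (regular v a)) (card_private_nbhdC vc (regular v c)).
have sub : private_nbhd a v \subset q |: private_nbhd c v.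
  apply/subsetP=> w; rewrite !inE => /and3P[aw wv vw]; rewrite wv vw.
  have [//|wq /=] := eqVneq w q.
  have cq : c != q by apply: contraTneq vc => ->; apply: ds_nadj dsa.
  have cv : c != v by rewrite eq_sym sedge_neq.
  have cw : c != w by apply: contraTneq vc => ->.
  have ac : sedge a c by rewrite sedge_sym.
  by rewrite andbT; apply: (ds_clique dsa); rewrite // !inE negb_or ?wv ?wq ?cv ?cq.
by apply: leq_trans (subset_leq_card sub) _; rewrite cardsU1; case: (_ \notin _).
Qed.

Lemma double_star_not_both v a b c :
  double_star (N v) a b -> c \in N v :\: [set a; b] -> sedge c a -> ~~ sedge c b.
Proof.
move=> ds cQ ca; apply/negP=> cb.
have := leq_trans (card_private_center_gt1 ds) (card_private_center ds cQ ca).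
rewrite ltnS card_gt0 => /set0Pn[w wc].
have := subsetP (private_nbhd_subset_centers ds cQ) w wc.
move: wc; rewrite !inE => /and3P[_ _ cw].
by case/orP=> /eqP wab; rewrite wab (ca, cb) in cw.
Qed.

Lemma double_star_leaf_unique v a b x x' : double_star (N v) a b ->
  x \in N v :\: [set a; b] -> x' \in N v :\: [set a; b] ->
  ~~ sedge x a -> ~~ sedge x' a -> x = x'.
Proof.
move=> ds xQ x'Q xa x'a; apply/eqP; apply: contraT => xx'.
have [z zQ zb] := ds_leaf_r ds.
have za : sedge z a by have := ds_dom ds zQ; rewrite (negbTE zb) orbF.
have private_z : #|private_nbhd v z| <= 1.
  rewrite -(cards1 b); apply/subset_leq_card/subsetP=> w wz.
  have := subsetP (private_nbhd_subset_centers ds zQ) w wz.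
  by move: wz; rewrite !inE => /and3P[_ _ zw] /orP[]// /eqP wa; rewrite wa za in zw.
have : 2 < #|private_nbhd v a|.
  have [[xP xb] [x'P x'b]] := (leaf_private xQ xa, leaf_private x'Q x'a).
  apply/card_gt2P; exists b, x, x'; rewrite eq_sym xb.
  by split=> //; split=> //; apply: center_private.
by have := card_private_center ds zQ za; lia.
Qed.

Lemma double_star_path_nbhd v a b :
  double_star (N v) a b -> exists x z, path_nbhd v b x z a.
Proof.
move=> ds; have ds' := double_star_sym ds.
have [x xQ xa] := ds_leaf_l ds; have [z zQ zb] := ds_leaf_r ds.
have xb : sedge x b by have := ds_dom ds xQ; rewrite (negbTE xa).
have za : sedge z a by have := ds_dom ds zQ; rewrite (negbTE zb) orbF.
have xz : x != z by apply: contraNneq zb => <-.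
exists x, z; split; last 2 first.
- by split=> //; [rewrite sedge_sym | apply: (ds_clique ds)].
- by split=> //; rewrite sedge_sym // (ds_nadj ds).
move=> y; rewrite !inE; apply/idP/idP; last first.
  move: (ds_center_l ds) (ds_center_r ds) xQ zQ.
  rewrite !inE => va vb /andP[_ vx] /andP[_ vz].
  by case/or4P=> /eqP->.
move=> vy; have [//|yb] := eqVneq y b.
have [|ya] := eqVneq y a; first by rewrite !orbT.
have yQ : y \in N v :\: [set a; b] by rewrite !inE negb_or ya yb.
have [ya'|ya'] := boolP (sedge y a); last first.
  by rewrite (double_star_leaf_unique ds yQ xQ ya' xa) eqxx.
have yb' := double_star_not_both ds yQ ya'; rewrite setUC in yQ zQ.
by rewrite (double_star_leaf_unique ds' yQ zQ yb' zb) eqxx !orbT.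
Qed.

Lemma regular_double_stars_locally_P4 : locally_P4.
Proof.
move=> v; have [a [b /double_star_path_nbhd[x [z vP]]]] := star v.
by exists b, x, z, a.
Qed.

End RegularDoubleStars.

Lemma path_nbhd_rev v p0 p1 p2 p3 :
  path_nbhd v p0 p1 p2 p3 -> path_nbhd v p3 p2 p1 p0.
Proof.
case=> [vE [p01 p12 p23] [p02 p03 p13]]; split; try by split; rewrite sedge_sym.
by move=> y; rewrite vE -mem_rev.
Qed.

Lemma path_nbhd_sedge v p0 p1 p2 p3 : path_nbhd v p0 p1 p2 p3 ->
  [/\ sedge v p0, sedge v p1, sedge v p2 & sedge v p3].
Proof. by move=> vP; split; rewrite (pn_mem vP) !inE eqxx ?orbT. Qed.

Lemma path_nbhd_neq v p0 p1 p2 p3 : path_nbhd v p0 p1 p2 p3 ->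
  [/\ p0 != p2, p0 != p3 & p1 != p3].
Proof.
case=> [_ [p01 p12 p23] [p02 p03 p13]]; split.
- by apply: contraTneq p23 => <-.
- by apply: contraTneq p01 => ->; rewrite sedge_sym.
- by apply: contraTneq p01 => ->.
Qed.

Lemma path_nbhd_end v p0 p1 p2 p3 y : path_nbhd v p0 p1 p2 p3 ->
  sedge v y -> sedge p0 y -> y = p1.
Proof.
move=> vP; rewrite (pn_mem vP) !inE; have [p02 p03 _] := pn_nadj vP.
by case/or4P=> /eqP-> //; rewrite ?sedge_irrefl ?(negbTE p02) ?(negbTE p03).
Qed.

Lemma path_nbhd_inner v p0 p1 p2 p3 y : path_nbhd v p0 p1 p2 p3 ->
  sedge v y -> sedge p1 y -> y = p0 \/ y = p2.
Proof.
move=> vP; rewrite (pn_mem vP) !inE; have [_ _ p13] := pn_nadj vP.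
by case/or4P=> /eqP->; rewrite ?sedge_irrefl ?(negbTE p13) //; [left | right].
Qed.

Lemma path_nbhd_orient v x p0 p1 p2 p3 : path_nbhd v p0 p1 p2 p3 -> sedge v x ->
  exists q0 q1 q2 q3, path_nbhd v q0 q1 q2 q3 /\ (x = q0 \/ x = q1).
Proof.
move=> vP; rewrite (pn_mem vP) !inE; case/or4P=> /eqP->.
- by exists p0, p1, p2, p3; split; [|left].
- by exists p0, p1, p2, p3; split; [|right].
- by exists p3, p2, p1, p0; split; [apply: path_nbhd_rev|right].
- by exists p3, p2, p1, p0; split; [apply: path_nbhd_rev|left].
Qed.

Lemma path_nbhd_no_isolated_edge v p0 p1 p2 p3 x y : path_nbhd v p0 p1 p2 p3 ->
  sedge v x -> sedge x y ->
  (forall t, sedge v t -> sedge x t -> t = y) ->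
  (forall t, sedge v t -> sedge y t -> t = x) -> False.
Proof.
move=> vP vx xy; have [q0 [q1 [q2 [q3 [{}vP xq]]]]] := path_nbhd_orient vP vx.
have [q01 q12 _] := pn_adj vP; have [q02 _ _] := path_nbhd_neq vP.
have [vq0 vq1 vq2 _] := path_nbhd_sedge vP.
case: xq => ->{x vx xy} onlyx onlyy; case/eqP: q02.
  by rewrite (onlyy q2) // -(onlyx q1).
by rewrite (onlyx q0 vq0) 1?(onlyx q2 vq2 q12) // sedge_sym.
Qed.

Lemma path_nbhd_twist_absurd v b x z a w : locally_P4 ->
  path_nbhd v b x z a -> path_nbhd z a v x w -> False.
Proof.
move=> paths vP zP; have [q0 [q1 [q2 [q3 aP]]]] := paths a.
have [_ _ vz va] := path_nbhd_sedge vP; have av : sedge a v by rewrite sedge_sym.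
apply: (path_nbhd_no_isolated_edge aP av vz) => t ta.
- by move=> vt; apply: path_nbhd_end (path_nbhd_rev vP) vt ta.
- by move=> zt; apply: path_nbhd_end zP zt ta.
Qed.

Lemma path_nbhd_shift v b x z a : locally_P4 ->
  path_nbhd v b x z a -> exists w, path_nbhd z x v a w.
Proof.
move=> paths vP; have [_ vx vz va] := path_nbhd_sedge vP.
have [_ xz za] := pn_adj vP; have [_ _ xa] := path_nbhd_neq vP.
have zx : sedge z x by rewrite sedge_sym.
have zv : sedge z v by rewrite sedge_sym.
have [p0 [p1 [p2 [p3 zP0]]]] := paths z.
have [q0 [q1 [q2 [q3 [zP vq]]]]] := path_nbhd_orient zP0 zv.
case: vq => vq; subst v.
  have := path_nbhd_end zP zx vx; rewrite -(path_nbhd_end zP za va) => ax.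
  by rewrite ax eqxx in xa.
case: (path_nbhd_inner zP zx vx) (path_nbhd_inner zP za va) => [] xq [] aq; subst x a.
- by rewrite eqxx in xa.
- by exists q3.
- by case: (path_nbhd_twist_absurd paths vP zP).
- by rewrite eqxx in xa.
Qed.

Definition path_square (u : nat -> G) : Prop :=
  forall i, path_nbhd (u i.+2) (u i) (u i.+1) (u i.+3) (u i.+4).

Lemma path_square_exists v : locally_P4 -> exists u : nat -> G, path_square u.
Proof.
move=> paths; have [p0 [p1 [p2 [p3 vP]]]] := paths v.
have /fin_all_exists[next nextP] (s : G * G * G * G * G) : exists w,
    let: (b, x, v, z, a) := s in path_nbhd v b x z a -> path_nbhd z x v a w.
  case: s => [[[[b x] c] z] a].
  have [/path_nbhd_shift-/(_ paths)[w wP]|not_path] := classic (path_nbhd c b x z a).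
    by exists w.
  by exists c.
pose step s := let: (b, x, v, z, a) := s in (x, v, z, a, next s).
pose window i := iter i step (p0, p1, v, p2, p3).
pose u i := (window i).1.1.1.1; exists u.
have windowE i : window i = (u i, u i.+1, u i.+2, u i.+3, u i.+4).
  by rewrite /u !/window /=; case: (iter i step _) => [[[[]]]].
elim=> [|i IH]; first by [].
have /= -> : u i.+4.+1 = next (window i).
  by rewrite /u /window /=; case: (iter i step _) => [[[[]]]].
by have := nextP (window i); rewrite windowE; apply.
Qed.

Section PathSquare.
Variable u : nat -> G.
Hypothesis uP : path_square u.

Lemma path_square_near i j : i < j <= i.+4 ->
  u i != u j /\ sedge (u i) (u j) = (j <= i.+2).
Proof.
move=> ij; have [n02 n03 _] := pn_nadj (uP i).
have [ne02 ne03 _] := path_nbhd_neq (uP i).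
have [u20 _ _ _] := path_nbhd_sedge (uP i); have [u01 _ _] := pn_adj (uP i).
have u02 : sedge (u i) (u i.+2) by rewrite sedge_sym.
have : j \in [:: i.+1; i.+2; i.+3; i.+4] by rewrite !inE; lia.
rewrite !inE => /or4P[]/eqP->; split; rewrite ?(sedge_neq u01) ?(sedge_neq u02) //;
  by rewrite (u01, u02, negbTE n02, negbTE n03); lia.
Qed.

(* The first vertex that repeats one of u 2, u 3, ... repeats u 2, since the two
   vertices before it are neighbours of the repeated vertex. *)
Lemma path_square_first_repetition : exists m,
  [/\ 4 < m, {in gtn m &, injective (fun i => u i.+2)}, u m.+2 = u 2
    & forall i, m <= i < m.+2 -> u i = u 0 \/ u i = u 1].
Proof.
have [m [uinj [j jm uj]]] := first_repetition (fun i => u i.+2); exists m.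
have far : j.+4 < m.
  rewrite ltnNge; apply/negP=> mj.
  by have [|/eqP[]] := @path_square_near j.+2 m.+2; first by lia.
have inj_at k l : k < m -> l < m -> u k.+2 = u l.+2 -> k = l.
  by move=> km lm; apply: uinj.
have preceding i : m <= i < m.+2 -> u i = u j \/ u i = u j.+1.
  move=> im; have : sedge (u j.+2) (u i).
    by rewrite uj sedge_sym; have [|_ ->] := @path_square_near i m.+2; lia.
  rewrite (pn_mem (uP j)) !inE; case: i im => [|[|i]] im; try by lia.
  case/or4P=> /eqP uE; [by left | by right | |]; have := inj_at i _ _ _ uE; lia.
suff j0 : j = 0 by subst j; split.
case: j jm far preceding {uj} => // j jm far preceding.
have only i : m <= i < m.+2 -> u i = u j.+1.
  move=> im; have [//|] := preceding i im; case: i im => [|[|i]] im uE; try by lia.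
  by have := inj_at i j _ _ uE; lia.
have [|/eqP[]] := @path_square_near m m.+1; first by lia.
by rewrite (only m) ?(only m.+1) //; lia.
Qed.

Lemma path_square_return : exists m,
  [/\ 4 < m, {in gtn m &, injective (fun i => u i.+2)}
    & forall i, i < 4 -> u (m + i) = u i].
Proof.
have [m [m4 uinj um2 preceding]] := path_square_first_repetition; exists m.
have um_neq : u m != u m.+1 by have [|] := @path_square_near m m.+1; first by lia.
have m2P := uP m; rewrite um2 in m2P.
have [s0 _ s3 _] := path_nbhd_sedge m2P; have [e01 e13 _] := pn_adj m2P.
have [ne03 _ _] := path_nbhd_neq m2P.
have um1 : u m.+1 = u 1.
  have [|um1|//] := preceding m.+1; first by lia.
  rewrite um1 in e01 e13; rewrite sedge_sym in e01.
  rewrite (path_nbhd_end (uP 0) s0 e01) (path_nbhd_end (uP 0) s3 e13) in ne03.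
  by rewrite eqxx in ne03.
have um0 : u m = u 0.
  have [|//|um0] := preceding m; first by lia.
  by rewrite um0 um1 eqxx in um_neq.
have um3 : u m.+3 = u 3.
  rewrite um1 in e13; have [um3|//] := path_nbhd_inner (uP 0) s3 e13.
  by rewrite um0 um3 eqxx in ne03.
by split=> // -[|[|[|[|i]]]] //; rewrite ?addn0 ?addn1 ?addn2 ?addn3.
Qed.

End PathSquare.

(* The square of a cycle of length m, as a component of G. *)
Record cycle_square m (w : nat -> G) : Prop := CycleSquare {
  cs_inj : {in gtn m &, injective w};
  cs_sedge : forall i j, i < j < m ->
    sedge (w i) (w j) = (j <= i.+2) || (i + m <= j.+2);
  cs_closed : forall i y, i < m -> sedge (w i) y -> exists2 j, j < m & y = w j }.

Lemma path_square_cycle_square (u : nat -> G) : path_square u ->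
  exists m, 6 < m /\ cycle_square m (fun i => u i.+2).
Proof.
move=> uP; have [m [m4 uinj uper]] := path_square_return uP; exists m.
have wrap t : t < m.+4 -> exists j, [/\ j < m, u t = u j.+2 &
    j.+2 = t \/ j.+2 = t + m \/ j.+2 + m = t].
  move=> tm; have [t2|t2] := ltnP t 2; last have [tm2|tm2] := ltnP t m.+2.
  - exists (t + m - 2); split; [lia | | lia].
    by rewrite -(uper t); [congr u|]; lia.
  - by exists t.-2; split; [lia | congr u; lia | lia].
  - exists (t - m - 2); split; [lia | | lia].
    by rewrite -(subnKC (_ : m <= t)) ?uper; [congr u|..]; lia.
have sedgeE i j : i < j < m ->
    sedge (u i.+2) (u j.+2) = (j <= i.+2) || (i + m <= j.+2).
  move=> ij; have u_eqE t : t < m.+4 ->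
      (u j.+2 == u t) = [|| j.+2 == t, j.+2 == t + m | j.+2 + m == t].
    move=> /wrap[k [km -> kt]]; rewrite (inj_in_eq uinj) ?inE; lia.
  by rewrite (pn_mem (uP i)) !inE !u_eqE; lia.
split; last split=> //.
  rewrite ltnNge; apply/negP=> m6; have [//|_] := path_square_near uP (i := 2) (j := 6).
  by rewrite sedgeE; lia.
move=> i y im; have image t : t < m.+4 -> exists2 j, j < m & u t = u j.+2.
  by move=> /wrap[j [jm utj _]]; exists j.
by rewrite (pn_mem (uP i)) !inE => /or4P[]/eqP->; apply: image; lia.
Qed.

(* A hole of length k in the square of the cycle of length m takes s steps of
   length 1 and k - s steps of length 2, no two of length 1 being consecutive. *)
Lemma hole_step_count m : 7 < m ->
  exists k s, [/\ odd k, 4 < k, m + s = k.*2 & s.*2 <= k].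
Proof.
move=> m7; exists (m + (3 * m + 2) %% 4)./2, ((3 * m + 2) %% 4).
split; lia.
Qed.

Lemma cycle_square_odd_hole m (w : nat -> G) :
  7 < m -> cycle_square m w -> hole_in [set: G].
Proof.
move=> /hole_step_count[k [s [kodd k5 mE sk]]] wP.
pose pos i := i.*2 - minn s i./2.
have pos_ltn i : i < k -> pos i < m by rewrite /pos; lia.
have pos_mono i j : i < j -> pos i < pos j by rewrite /pos; lia.
apply: (@hole_in_seq _ _ (w \o pos) k) => //.
  move=> i j ik jk /(cs_inj wP) eij.
  have := eij (pos_ltn i ik) (pos_ltn j jk).
  by have [/pos_mono|/pos_mono|//] := ltngtP i j; lia.
move=> i j /andP[ij jk]; rewrite /= (cs_sedge wP) ?pos_mono ?pos_ltn //.
by rewrite /pos; lia.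
Qed.

(* Multiplication by 3 modulo 7 maps the differences 2, 3, 4, 5 of non-adjacent
   vertices of C_7 to 6, 2, 5, 1. *)
Lemma cycle_square7_isomorphic (w : nat -> G) :
  connected_graph G -> cycle_square 7 w ->
  isomorphic G (compl_graph (cycle_graph 7)).
Proof.
move=> Gconn wP; pose h (i : 'I_7) := w (3 * i %% 7).
have hinj : injective h.
  move=> i j /(cs_inj wP); rewrite !inE !ltn_mod => /(_ isT isT) eij.
  by apply/val_inj => /=; have := ltn_ord i; have := ltn_ord j; lia.
have h_sedge (i j : 'I_7) :
    i < j -> sedge (h i) (h j) = compl_rel (G := cycle_graph 7) i j.
  move=> ij; have j7 := ltn_ord j.
  have ij_neq : (i : cycle_graph 7) != j by apply: contraTneq ij => ->; rewrite ltnn.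
  rewrite /compl_rel ij_neq -[sedge (s := cycle_graph 7) _ _]/(cycle_rel i j).
  rewrite cycle_relE //.
  have [dij|dji] := ltnP (3 * i %% 7) (3 * j %% 7); last rewrite sedge_sym.
    by rewrite (cs_sedge wP); lia.
  by rewrite (cs_sedge wP); lia.
apply: (@embedding_isomorphic G (compl_graph (cycle_graph 7)) h ord0 Gconn hinj).
  exact: (sedge_mono_ltn (@compl_sym (cycle_graph 7))
                        (@compl_irrefl (cycle_graph 7))).
move=> i y hiy; have [|j j7 ->] := cs_closed wP _ hiy; first by rewrite ltn_mod.
apply/codomP; exists (inord (5 * j %% 7)); rewrite /h inordK ?ltn_mod //.
by congr w; lia.
Qed.

Theorem locally_P4_odd_hole_or_coC7 (v : G) : connected_graph G -> locally_P4 ->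
  hole_in [set: G] \/ isomorphic G (compl_graph (cycle_graph 7)).
Proof.
move=> Gconn /(path_square_exists v)[u /path_square_cycle_square[m [m6 uP]]].
have [m7|m7] := ltnP 7 m; first by left; apply: cycle_square_odd_hole uP.
right; apply: (cycle_square7_isomorphic (w := fun i => u i.+2)) => //.
by have <- : m = 7 by lia.
Qed.

End LocallyP4.

Theorem theorem2 (G : sgraph) (Gconn : connected_graph G)
    (chi_Delta : chromatic_number G = max_degree G)
    (notC7 : ~ isomorphic G (compl_graph (cycle_graph 7))) :
  contains_subgraph G (complete_graph (max_degree G)) \/ has_high_odd_hole G.
Proof.
case Delta: (max_degree G) => [|n].
  by left; exists (fun i : 'I_0 => False_rect G (notF (ltn_ord i))) => -[].
have uncolorable : ~ colorable_on n [set: G].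
  by move=> /chromatic_number_leq; rewrite chi_Delta Delta ltnn.
have [U Ucrit] := critical_exists uncolorable.
have [K|noclique] := classic (has_clique G n.+1).
  by left; apply: has_clique_subgraph.
right; apply: NNPP => nohigh.
have nohole : ~ hole_in U.
  case=> k [h [hP hU]]; apply: nohigh; exists k, h; split=> // i; rewrite Delta.
  exact: leq_trans (critical_card_nbhd Ucrit (hU i)) (card_nbhd_degree U _).
have stars := critical_regular_double_stars Gconn Delta Ucrit nohole noclique.
have regular (u v : G) : degree u = degree v by rewrite (stars u).1 (stars v).1.
have paths := regular_double_stars_locally_P4 regular (fun u => (stars u).2).
have [v _] := critical_nonempty Ucrit.
case: (locally_P4_odd_hole_or_coC7 v Gconn paths) => // -[k [h [hP _]]].
by apply: nohigh; exists k, h; split=> // i; rewrite Delta (stars _).1.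
Qed.
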